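(* Let $u\in\mathbb{R}$, let $R$ be a commutative noetherian ring, let $I,\mathfrak{a}\subset R$ be ideals of positive height, and let $t\in\mathbb{R}_{>0}$. Then (a) $\overline{I}^{\mathfrak{a}^t}=\{x\in R\mid\text{for some }c\in R^\circ\text{ and all }n\gg0,\ cx^n\mathfrak{a}^{\lceil tn+u\rceil}\subset I^n\}$. If moreover $R$ has prime characteristic $p>0$, then (b) $I^{*\mathfrak{a}^t}=\{x\in R\mid\text{for some }c\in R^\circ\text{ and all }e\gg0,\ cx^{p^e}\mathfrak{a}^{\lceil tp^e+u\rceil}\subset I^{[p^e]}\}$, and (c) ${}^{\mathfrak{a}^t}I^*=\{x\in R\mid\text{for some }c\in R^\circ\text{ and all }e\gg0,\ cx^{p^e}\mathfrak{a}^{\lceil tp^e+u\rceil}\subset I^{[p^e]}\mathfrak{a}^{\lceil tp^e+u\rceil}\}$.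
   Context: All rings are commutative with unit and noetherian. $R^\circ$ is the set of elements of $R$ not in any minimal prime of $R$. An ideal has positive height if it is not contained in any minimal prime. Non-positive powers of ideals are interpreted as the entire ring. $I^{[p^e]}$ is the ideal generated by $\{r^{p^e}\mid r\in I\}$. Definitions: $$\overline{I}^{\mathfrak{a}^t}=\{x\in R\mid\text{for some }c\in R^\circ\text{ and all }n\gg0,\ cx^n\mathfrak{a}^{\lceil tn\rceil}\subset I^n\},$$ $$I^{*\mathfrak{a}^t}=\{x\in R\mid\text{for some }c\in R^\circ\text{ and all }e\gg0,\ cx^{p^e}\mathfrak{a}^{\lceil tp^e\rceil}\subset I^{[p^e]}\},$$ $${}^{\mathfrak{a}^t}I^*=\{x\in R\mid\text{for some }c\in R^\circ\text{ and all }e\gg0,\ cx^{p^e}\mathfrak{a}^{\lceil tp^e\rceil}\subset\mathfrak{a}^{\lceil tp^e\rceil}I^{[p^e]}\}.$$ *)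

(* Defs.v *)
From mathcomp Require Import all_boot all_order all_algebra.
From mathcomp Require Import boolp classical_sets reals filter.

Set Implicit Arguments.
Unset Strict Implicit.
Unset Printing Implicit Defensive.

Import Order.TTheory GRing.Theory Num.Theory.
Local Open Scope classical_set_scope.
Local Open Scope ring_scope.

(* Ideals are classical sets, possibly equal to the whole ring: the [idealr] of
   [ring_quotient] are decidable and always proper, whereas [I ^ 0 = R] is
   needed here.  Rings are [comPzRingType] so that the zero ring is allowed. *)
Section Ideals.
Variable R : comPzRingType.
Implicit Types (I J a P : set R) (x c : R).

Definition is_ideal I : Prop :=
  [/\ I 0, forall x y, I x -> I y -> I (x + y) & forall r x, I x -> I (r * x)].

Definition ideal_gen (S : set R) : set R := smallest is_ideal S.

Definition noetherian : Prop :=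
  forall I, is_ideal I -> exists s : seq R, I = ideal_gen [set` s].

Definition is_prime_ideal P : Prop :=
  [/\ is_ideal P, ~ P 1 & forall x y, P (x * y) -> P x \/ P y].

Definition is_minimal_prime P : Prop :=
  is_prime_ideal P /\ forall Q, is_prime_ideal Q -> Q `<=` P -> Q = P.

(* R° *)
Definition Rcirc : set R := [set c | forall P, is_minimal_prime P -> ~ P c].

Definition positive_height I : Prop :=
  forall P, is_minimal_prime P -> ~ I `<=` P.

Definition ideal_mul I J : set R := ideal_gen [set x * y | x in I & y in J].

(* For an ideal I, I * R = I, so this is I^n also for n = 1. *)
Fixpoint ideal_pow I (n : nat) : set R :=
  if n is m.+1 then ideal_mul I (ideal_pow I m) else setT.

(* Non-positive powers are the whole ring. *)
Definition ideal_powz I (k : int) : set R :=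
  if k is Posz n then ideal_pow I n else setT.

(* I^[q]; below q is p ^ e *)
Definition frob_pow I (q : nat) : set R := ideal_gen [set r ^+ q | r in I].

(* c x^n a^k, as a set *)
Definition smul_powz c x (n : nat) a (k : int) : set R :=
  [set c * x ^+ n * y | y in ideal_powz a k].

Section Closures.
Variable K : realType.

(* The closure of I written with an overline and exponent a^t *)
Definition integral_closure I a (t : K) : set R :=
  [set x | exists2 c, Rcirc c &
     \forall n \near \oo,
       smul_powz c x n a (Num.ceil (t * n%:R)) `<=` ideal_pow I n].

(* I^{*a^t}; only meaningful in characteristic p *)
Definition right_tight_closure (p : nat) I a (t : K) : set R :=
  [set x | exists2 c, Rcirc c &
     \forall e \near \oo,
       smul_powz c x (p ^ e) a (Num.ceil (t * (p ^ e)%:R))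
         `<=` frob_pow I (p ^ e)].

(* ^{a^t}I^*; only meaningful in characteristic p *)
Definition left_tight_closure (p : nat) I a (t : K) : set R :=
  [set x | exists2 c, Rcirc c &
     \forall e \near \oo,
       smul_powz c x (p ^ e) a (Num.ceil (t * (p ^ e)%:R))
         `<=` ideal_mul (ideal_powz a (Num.ceil (t * (p ^ e)%:R)))
                        (frob_pow I (p ^ e))].

End Closures.
End Ideals.

(* [pchar] is only available for nonzero rings; see [has_prime_charE]. *)
Definition has_prime_char (R : comPzRingType) (p : nat) : Prop :=
  [/\ prime p, (1 : R) <> 0 & p%:R = 0 :> R].

Lemma has_prime_charE (R : comNzRingType) (p : nat) :
  has_prime_char R p <-> p \in [pchar R].
Proof.
split=> [[pp _ p0]|/andP[pp /eqP p0]]; first by apply/andP; split=> //; apply/eqP.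
by split=> //; apply/eqP; rewrite oner_eq0.
Qed.

Arguments noetherian R : clear implicits.

(* Main.v *)
Require Import Defs.
From mathcomp Require Import all_boot all_order all_algebra.
From mathcomp Require Import boolp classical_sets reals filter.
From mathcomp Require Import zify ring.

(** The exponents [ceil (t * n)] and [ceil (t * n + u)] differ by at most a
    constant [M] independent of [n], so it is enough to see that each of the
    three conditions survives a bounded change of the exponents of [a], at the
    price of changing [c].

    The price is paid with an element [d] of [a] lying in no minimal prime:
    [d ^+ M] multiplies [a ^ l] into [a ^ (l + M)], hence into [a ^ k] as soon
    as [k <= l + M], and [d ^+ M * c] is again in no minimal prime.  This
    settles (a) and (b), whose right-hand sides do not involve [a]
    ([smul_powz_shift]).  In (c) the right-hand side moves too.  If the
    exponent decreases, the new right-hand side is larger and the same argument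
    applies; if it increases from [k] to [l], multiplying
    [w a^k <= a^k J] by [a^(l - k)] gives [w a^l <= a^l J]
    ([smul_powz_shift_mul]).

    The existence of [d] ([positive_height_Rcirc]) is prime avoidance, once the
    minimal primes are known to be finite in number ([fin_minimal_primes]).
    Finiteness is proved by noetherian induction on an ideal [J], for the claim
    that every prime above [J] contains a member of some fixed finite list of primes:
    when [x * y] is in [J] but neither [x] nor [y] is, every prime above [J] is
    above [J + (x)] or [J + (y)]. *)

Set Implicit Arguments.
Unset Strict Implicit.
Unset Printing Implicit Defensive.

Import Order.TTheory GRing.Theory Num.Theory.
Local Open Scope classical_set_scope.
Local Open Scope ring_scope.

(** * Ideals and their products *)

Section IdealTheory.
Variable R : comPzRingType.
Implicit Types (I J A B P Q : set R) (x y c d : R).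

Lemma is_ideal_gen (S : set R) : is_ideal (ideal_gen S).
Proof.
split=> [J [[]]//|x y gx gy J JP|r x gx J JP].
  by case: (JP) => -[_ addJ _] _; apply: addJ; [apply: gx | apply: gy].
by case: (JP) => -[_ _ mulJ] _; apply: mulJ; apply: gx.
Qed.

Lemma is_ideal_setT : is_ideal [set: R]. Proof. by []. Qed.

Lemma is_ideal_mul A B : is_ideal (ideal_mul A B).
Proof. exact: is_ideal_gen. Qed.

Lemma mem_ideal_mul A B x y : A x -> B y -> ideal_mul A B (x * y).
Proof. by move=> Ax By; apply: sub_gen_smallest; exists x => //; exists y. Qed.

Lemma ideal_mul_sub A B J : is_ideal J ->
  (forall x y, A x -> B y -> J (x * y)) -> ideal_mul A B `<=` J.
Proof.
by move=> Ji ABJ; apply: smallest_sub => // _ [x Ax [y By <-]]; apply: ABJ.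
Qed.

Lemma ideal_mulC A B : ideal_mul A B = ideal_mul B A.
Proof.
by apply/seteqP; split; apply: ideal_mul_sub; do ?exact: is_ideal_mul;
  move=> x y Ax By; rewrite mulrC; apply: mem_ideal_mul.
Qed.

Lemma ideal_mulSl A A' B : A `<=` A' -> ideal_mul A B `<=` ideal_mul A' B.
Proof.
move=> AA'; apply: ideal_mul_sub; first exact: is_ideal_mul.
by move=> x y /AA' A'x By; apply: mem_ideal_mul.
Qed.

Lemma is_ideal_preim_mul w J : is_ideal J -> is_ideal [set z | J (w * z)].
Proof.
case=> J0 addJ mulJ; split=> [|x y /= Jx Jy|r x /= Jx]; rewrite /= ?mulr0 //.
  by rewrite mulrDr; apply: addJ.
by rewrite mulrCA; apply: mulJ.
Qed.

(** * Powers of an ideal *)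

Lemma is_ideal_pow A n : is_ideal (ideal_pow A n).
Proof. by case: n => [|n]; [exact: is_ideal_setT | exact: is_ideal_mul]. Qed.

Lemma ideal_pow_anti A m n : (m <= n)%N -> ideal_pow A n `<=` ideal_pow A m.
Proof.
move=> /subnK <-; elim: (n - m)%N => [//|k IH]; rewrite addSn.
apply: subset_trans IH; apply: ideal_mul_sub; first exact: is_ideal_pow.
by move=> x y _ Ay; case: (is_ideal_pow A (k + m)) => _ _; apply.
Qed.

(** Truncating at zero reduces integer exponents to natural ones. *)
Lemma ideal_powzE A (k : int) :
  ideal_powz A k = ideal_pow A `|Num.max (0 : int) k|%N.
Proof.
by case: k => n; [rewrite max_r | rewrite max_l].
Qed.

Lemma ideal_powz_anti A (k l : int) :
  k <= l -> ideal_powz A l `<=` ideal_powz A k.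
Proof. by move=> kl; rewrite !ideal_powzE; apply: ideal_pow_anti; lia. Qed.

Lemma ideal_pow_expM A d m n y :
  A d -> ideal_pow A n y -> ideal_pow A (m + n) (d ^+ m * y).
Proof.
move=> Ad Any; elim: m => [|m IH]; first by rewrite expr0 mul1r.
by rewrite exprS -mulrA; apply: mem_ideal_mul.
Qed.

Lemma ideal_powz_expM A d m (l : int) y :
  A d -> ideal_powz A l y -> ideal_powz A (l + m%:Z) (d ^+ m * y).
Proof.
rewrite !ideal_powzE => Ad /(ideal_pow_expM m Ad).
by apply: ideal_pow_anti; lia.
Qed.

(** An increase of the exponent multiplies both sides of the inclusion
    [w a^k <= a^k J] by the same power of [a]. *)
Lemma ideal_powz_mul_stable w A J (k l : int) : k <= l ->
  (forall y, ideal_powz A k y -> ideal_mul (ideal_powz A k) J (w * y)) ->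
  forall y, ideal_powz A l y -> ideal_mul (ideal_powz A l) J (w * y).
Proof.
move=> kl; rewrite !ideal_powzE.
have /subnK <- : (`|Num.max (0 : int) k| <= `|Num.max (0 : int) l|)%N by lia.
move: `|Num.max (0 : int) k|%N (_ - _)%N => m j step.
elim: j => [//|j IH]; rewrite addSn /=.
set B := ideal_pow A (j + m) in IH *.
suff BP : ideal_mul A B `<=` [set y | ideal_mul (ideal_mul A B) J (w * y)].
  exact: BP.
apply: ideal_mul_sub; first exact/is_ideal_preim_mul/is_ideal_mul.
move=> x y Ax /IH; rewrite /= mulrCA.
apply: (ideal_mul_sub (J := [set z | ideal_mul (ideal_mul A B) J (x * z)])).
  exact/is_ideal_preim_mul/is_ideal_mul.
move=> b z Bb Jz /=; rewrite mulrA.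
by apply: mem_ideal_mul => //; apply: mem_ideal_mul.
Qed.

(** * Bounded changes of the exponent *)

Lemma smul_powz_shift A J c d x n M (k l : int) :
  A d -> k <= l + M%:Z -> smul_powz c x n A k `<=` J ->
  smul_powz (d ^+ M * c) x n A l `<=` J.
Proof.
move=> Ad klM cJ _ [y Aly <-]; apply: cJ; exists (d ^+ M * y); last by ring.
exact: (ideal_powz_anti klM) (ideal_powz_expM M Ad Aly).
Qed.

Lemma smul_powz_shift_mul A J c d x n M (k l : int) :
  A d -> k <= l + M%:Z ->
  smul_powz c x n A k `<=` ideal_mul (ideal_powz A k) J ->
  smul_powz (d ^+ M * c) x n A l `<=` ideal_mul (ideal_powz A l) J.
Proof.
move=> Ad klM cJ; have [kl|/ltW lk] := leP k l.
  move=> _ [y Aly <-]; rewrite -2!mulrA.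
  case: (is_ideal_mul (ideal_powz A l) J) => _ _; apply; rewrite mulrA.
  by apply: ideal_powz_mul_stable kl _ _ Aly => z Akz; apply: cJ; exists z.
apply: smul_powz_shift Ad klM _.
exact: subset_trans cJ (ideal_mulSl (ideal_powz_anti lk)).
Qed.

Lemma Rcirc_mul c d : Rcirc c -> Rcirc d -> Rcirc (c * d).
Proof.
by move=> cR dR P mP; case: (mP) => -[_ _ prP] _ /prP[/(cR _ mP)|/(dR _ mP)].
Qed.

Lemma Rcirc_exp d n : Rcirc d -> Rcirc (d ^+ n).
Proof.
move=> dR; elim: n => [P [[]]//|n IH].
by rewrite exprS; apply: Rcirc_mul.
Qed.

(** The common shape of the three parts: [C c n k] is the inclusion at index [n]
    with multiplier [c] and exponent [k]. *)
Lemma near_shift d M (C : R -> nat -> int -> Prop) (f g : nat -> int) :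
  Rcirc d -> (forall n, f n <= g n + M%:Z) ->
  (forall c n k l, k <= l + M%:Z -> C c n k -> C (d ^+ M * c) n l) ->
  (exists2 c, Rcirc c & \forall n \near \oo, C c n (f n)) ->
  exists2 c, Rcirc c & \forall n \near \oo, C c n (g n).
Proof.
move=> dR fgM Cshift [c cR cn]; exists (d ^+ M * c).
  by apply: Rcirc_mul => //; apply: Rcirc_exp.
by apply: filterS cn => n; apply: Cshift.
Qed.

(** * Finiteness of the set of minimal primes *)

(** Noetherian induction.  A failure at [J] would propagate to an infinite
    strictly ascending chain of ideals, but the finitely many generators of the
    union of the chain already lie in one of its terms. *)
Lemma noetherian_ind (prop : set R -> Prop) : noetherian R ->
  (forall J, is_ideal J ->
     (forall J', is_ideal J' -> J `<` J' -> prop J') -> prop J) ->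
  forall J, is_ideal J -> prop J.
Proof.
move=> Rn step J0 J0i; apply: contrapT => nJ0.
pose bad := {J : set R | is_ideal J /\ ~ prop J}.
have larger (J : bad) : exists J' : bad, sval J `<` sval J'.
  case: J => J [Ji nJ] /=; apply: contrapT => noJ'.
  apply: nJ; apply: step => // J' J'i JJ'; apply: contrapT => nJ'.
  by apply: noJ'; exists (exist _ J' (conj J'i nJ')).
pose next (J : bad) : bad := sval (cid (larger J)).
pose chain n := sval (iter n next (exist _ J0 (conj J0i nJ0))).
have chainS n : chain n `<` chain n.+1 by rewrite /chain iterS; exact: svalP (cid (larger _)).
have chain_ideal n : is_ideal (chain n).
  by rewrite /chain; case: (iter _ _ _) => ? [].
have chain_le m n : (m <= n)%N -> chain m `<=` chain n.
  move=> /subnK <-; elim: (n - m)%N => [//|k IH]; rewrite addSn.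
  exact: subset_trans IH (properW (chainS _)).
have chainU_ideal : is_ideal (\bigcup_n chain n).
  split=> [|x y [m _ xm] [n _ yn]|r x [n _ xn]].
  - by exists 0%N => //; case: (chain_ideal 0%N).
  - exists (maxn m n) => //; case: (chain_ideal (maxn m n)) => _ addJ _.
    by apply: addJ; [apply: chain_le xm | apply: chain_le yn];
      rewrite ?leq_maxl ?leq_maxr.
  - by exists n => //; case: (chain_ideal n) => _ _; apply.
have [s sE] := Rn _ chainU_ideal.
have [n sn] : exists n, forall x, x \in s -> chain n x.
  have : forall x, x \in s -> exists n, chain n x.
    move=> x xs; have [n _ xn] : (\bigcup_n chain n) x.
      by rewrite sE; apply: sub_gen_smallest.
    by exists n.
  elim: s {sE} => [|x s IH] xs; first by exists 0%N.
  have [m xm] := xs x (mem_head _ _).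
  have [|n sn] := IH; first by move=> y ys; apply: xs; rewrite inE ys orbT.
  exists (maxn m n) => y; rewrite inE => /orP[/eqP->|/sn].
    exact: chain_le (leq_maxl _ _) _ xm.
  exact: chain_le (leq_maxr _ _) _.
have [_] := chainS n; apply; apply: (@subset_trans _ (\bigcup_n chain n)).
  exact: bigcup_sup.
by rewrite sE; apply: smallest_sub.
Qed.

Definition adjoin J x : set R := [set z | exists2 j, J j & exists r, z = j + r * x].

Lemma is_ideal_adjoin J x : is_ideal J -> is_ideal (adjoin J x).
Proof.
case=> J0 addJ mulJ; split=> [|_ _ [j Jj [r ->]] [k Jk [s ->]]|q _ [j Jj [r ->]]].
- by exists 0 => //; exists 0; ring.
- by exists (j + k); [apply: addJ | exists (r + s); ring].
- by exists (q * j); [apply: mulJ | exists (q * r); ring].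
Qed.

Lemma proper_adjoin J x : is_ideal J -> ~ J x -> J `<` adjoin J x.
Proof.
case=> J0 _ _ nJx; split=> [z Jz|/(_ x)].
  by exists z => //; exists 0; ring.
by move=> sub; apply: nJx; apply: sub; exists 0 => //; exists 1; ring.
Qed.

Lemma adjoin_sub J x Q : is_ideal Q -> J `<=` Q -> Q x -> adjoin J x `<=` Q.
Proof.
by case=> _ addQ mulQ JQ Qx _ [j /JQ Qj [r ->]]; apply: addQ => //; apply: mulQ.
Qed.

(** Asking only that every prime above [J] contains a member of the list, which
    need not itself lie above [J] or be minimal, makes the lists obtained for
    two larger ideals simply concatenate. *)
Lemma fin_coinitial_primes J : noetherian R -> is_ideal J ->
  exists s : seq (set R), (forall P, P \in s -> is_prime_ideal P) /\
    forall Q, is_prime_ideal Q -> J `<=` Q -> exists2 P, P \in s & P `<=` Q.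
Proof.
move=> Rn; move: J; apply: (noetherian_ind Rn) => J Ji IH.
have [Jpr|nJpr] := pselect (is_prime_ideal J).
  by exists [:: J]; split=> [P|Q _ JQ]; [rewrite inE => /eqP-> |
    exists J; rewrite ?mem_head].
have [J1|nJ1] := pselect (J 1).
  by exists [::]; split=> // Q [_ nQ1 _] /(_ _ J1) /nQ1.
have [x [y [Jxy nJx nJy]]] : exists x y, [/\ J (x * y), ~ J x & ~ J y].
  apply: contrapT => noxy; apply: nJpr; split=> // x y Jxy.
  by apply: contrapT => /not_orP[nJx nJy]; apply: noxy; exists x, y.
have [sx [sx_pr sx_coin]] := IH _ (is_ideal_adjoin x Ji) (proper_adjoin Ji nJx).
have [sy [sy_pr sy_coin]] := IH _ (is_ideal_adjoin y Ji) (proper_adjoin Ji nJy).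
exists (sx ++ sy); split=> [P|Q Qpr JQ].
  by rewrite mem_cat => /orP[/sx_pr|/sy_pr].
have [Qi _ prQ] := Qpr; case: (prQ _ _ (JQ _ Jxy)) => Qz.
  have [P Ps PQ] := sx_coin _ Qpr (adjoin_sub Qi JQ Qz).
  by exists P; rewrite // mem_cat Ps.
have [P Ps PQ] := sy_coin _ Qpr (adjoin_sub Qi JQ Qz).
by exists P; rewrite // mem_cat Ps orbT.
Qed.

(** A prime inside a minimal prime is equal to it. *)
Lemma fin_minimal_primes : noetherian R ->
  exists s : seq (set R), forall P, is_minimal_prime P -> P \in s.
Proof.
move=> Rn; have [|s [s_pr s_coin]] := @fin_coinitial_primes [set 0] Rn.
  by split=> [|_ _ -> ->|r _ ->]; rewrite /= ?addr0 ?mulr0.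
exists s => P [Ppr Pmin]; case: (Ppr) => -[P0 _ _] _ _.
have [|Q Qs QP] := s_coin _ Ppr; first by move=> _ ->.
by rewrite -(Pmin _ (s_pr _ Qs) QP).
Qed.

(** * Avoiding the minimal primes *)

(** Distinct minimal primes are incomparable, and a product of elements outside
    a prime stays outside it. *)
Lemma mem_other_minimal_primes (s : seq (set R)) P : is_minimal_prime P ->
  exists2 z, ~ P z &
    forall Q, Q \in s -> is_minimal_prime Q -> Q <> P -> Q z.
Proof.
move=> [Ppr Pmin]; elim: s => [|Q s [z nPz sz]]; first by exists 1; case: Ppr.
have [[Qmin QP]|nQ] := pselect (is_minimal_prime Q /\ Q <> P); last first.
  exists z => // Q'; rewrite inE => /orP[/eqP-> Qmin QP|]; last exact: sz.
  by case: nQ.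
have [w Qw nPw] : exists2 w, Q w & ~ P w.
  apply: contrapT => now; apply: QP; apply: Pmin; first by case: Qmin.
  by move=> w Qw; apply: contrapT => nPw; apply: now; exists w.
case: (Ppr) => _ _ prP; exists (w * z) => [/prP[]//|Q'].
rewrite inE => /orP[/eqP-> [[[_ _ mulQ] _ _] _] _|Q's Q'min Q'P].
  by rewrite mulrC; apply: mulQ.
by case: (Q'min) => -[[_ _ mulQ'] _ _] _; apply: mulQ'; apply: sz.
Qed.

Lemma minimal_prime_avoidance (s : seq (set R)) A :
  is_ideal A -> positive_height A ->
  exists2 d, A d & forall P, P \in s -> is_minimal_prime P -> ~ P d.
Proof.
move=> Ai Aht; case: (Ai) => A0 addA mulA.
elim: s => [|P s [d Ad sd]]; first by exists 0.
have [[Pmin Pd]|nPd] := pselect (is_minimal_prime P /\ P d); last first.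
  exists d => // Q; rewrite inE => /orP[/eqP-> Pmin Pd|]; last exact: sd.
  by apply: nPd.
have [y Ay nPy] : exists2 y, A y & ~ P y.
  apply: contrapT => noy; apply: (Aht _ Pmin) => y Ay.
  by apply: contrapT => nPy; apply: noy; exists y.
have [z nPz sz] := mem_other_minimal_primes s Pmin.
have addI Q u v : is_minimal_prime Q -> Q u -> Q (u + v) -> Q v.
  case=> -[[_ addQ mulQ] _ _] _ Qu Quv.
  by rewrite (_ : v = u + v + -1 * u); [apply/addQ/mulQ | ring].
(* [z * y] is outside [P], which contains [d], and inside the other minimal
   primes of the list, which do not. *)
exists (d + z * y); first by apply: addA => //; apply: mulA.
have nPzy : ~ P (z * y) by case: (Pmin) => -[_ _ prP] _ /prP[].
move=> Q; have [-> _ _ /(addI _ _ _ Pmin Pd)//|QP] := pselect (Q = P).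
rewrite inE => /orP[/eqP/QP[]|Qs Qmin]; rewrite addrC => Qd.
apply: (sd _ Qs Qmin); apply: (addI _ _ _ Qmin _ Qd); rewrite mulrC.
by case: (Qmin) => -[[_ _ mulQ] _ _] _; apply: mulQ; apply: sz.
Qed.

Lemma positive_height_Rcirc A : noetherian R ->
  is_ideal A -> positive_height A -> exists2 d, A d & Rcirc d.
Proof.
move=> Rn Ai Aht; have [s s_min] := fin_minimal_primes Rn.
have [d Ad sd] := minimal_prime_avoidance s Ai Aht.
by exists d => // P Pmin; apply: sd => //; apply: s_min.
Qed.

End IdealTheory.

(** * Shifting the exponents of the closures *)

Lemma ceilD_le (K : realType) (x u : K) :
  Num.ceil (x + u) <= Num.ceil x + Num.ceil u.
Proof. by rewrite ceil_le_int intrD lerD// ceil_ge. Qed.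

Lemma ceil_shift (K : realType) (u : K) : exists M : nat, forall x : K,
  Num.ceil x <= Num.ceil (x + u) + M%:Z /\
  Num.ceil (x + u) <= Num.ceil x + M%:Z.
Proof.
exists (`|Num.ceil u| + `|Num.ceil (- u)|)%N => x.
have := ceilD_le x u; have := ceilD_le (x + u) (- u); rewrite addrK.
move: (Num.ceil _) (Num.ceil _) (Num.ceil _) (Num.ceil _) => i j k l.
by lia.
Qed.

Theorem theorem4p9 (K : realType) (u : K) (R : comPzRingType)
  (R_noeth : noetherian R) (I a : set R)
  (I_ideal : is_ideal I) (a_ideal : is_ideal a)
  (I_ht : positive_height I) (a_ht : positive_height a)
  (t : K) (t_gt0 : 0 < t) :
  integral_closure I a t =
    [set x | exists2 c, Rcirc c &
       \forall n \near \oo,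
         smul_powz c x n a (Num.ceil (t * n%:R + u)) `<=` ideal_pow I n]
  /\
  (forall p : nat, has_prime_char R p ->
    right_tight_closure p I a t =
      [set x | exists2 c, Rcirc c &
         \forall e \near \oo,
           smul_powz c x (p ^ e) a (Num.ceil (t * (p ^ e)%:R + u))
             `<=` frob_pow I (p ^ e)]
    /\
    left_tight_closure p I a t =
      [set x | exists2 c, Rcirc c &
         \forall e \near \oo,
           smul_powz c x (p ^ e) a (Num.ceil (t * (p ^ e)%:R + u))
             `<=` ideal_mul (frob_pow I (p ^ e))
                    (ideal_powz a (Num.ceil (t * (p ^ e)%:R + u)))]).

Proof.
have [d ad dR] := positive_height_Rcirc R_noeth a_ideal a_ht.
have [M ceilM] := ceil_shift u.
have shift C (q : nat -> nat) :
    (forall c n (k l : int), k <= l + M%:Z -> C c n k -> C (d ^+ M * c) n l) ->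
    (exists2 c, Rcirc c &
       \forall n \near \oo, C c n (Num.ceil (t * (q n)%:R))) <->
    (exists2 c, Rcirc c &
       \forall n \near \oo, C c n (Num.ceil (t * (q n)%:R + u))).
  move=> Cshift; split.
    by apply: near_shift dR _ Cshift => n; case: (ceilM (t * (q n)%:R)).
  by apply: near_shift dR _ Cshift => n; case: (ceilM (t * (q n)%:R)).
split; last move=> p _; last split.
- apply/predeqP => x.
  apply: (shift (fun c n k => smul_powz c x n a k `<=` ideal_pow I n) id).
  by move=> c n k l; apply: smul_powz_shift.
- apply/predeqP => x.
  apply: (shift (fun c e k => smul_powz c x (p ^ e) a k `<=` frob_pow I (p ^ e))).
  by move=> c e k l; apply: smul_powz_shift.
- apply/predeqP => x.
  have [|to_shift of_shift] := shift (fun c e k => smul_powz c x (p ^ e) a k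
    `<=` ideal_mul (ideal_powz a k) (frob_pow I (p ^ e))) (expn p).
    by move=> c e k l; apply: smul_powz_shift_mul.
  split=> [/to_shift|] [c cR cn]; [|apply: of_shift]; exists c => //.
    by apply: filterS cn => e; rewrite ideal_mulC.
  by apply: filterS cn => e; rewrite ideal_mulC.
Qed.
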